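(* Let $n$ be a nonnegative integer and let $a,c$ be complex numbers such that no lower parameter of the series below is a nonpositive integer and all denominators below are nonzero. Then $$\frac{(c-a)_n}{(c)_n}=\frac{1-c}{1-c-n}\;{}_4F_3\left[\begin{matrix}-\frac n2,\ \frac{1-n}{2},\ a,\ 1-a\\ \frac12,\ c-1,\ 2-c-n\end{matrix};1\right]-\frac{n(1-a)}{1-c-n}\;{}_4F_3\left[\begin{matrix}\frac{1-n}{2},\ \frac{2-n}{2},\ a,\ 2-a\\ \frac32,\ c,\ 2-c-n\end{matrix};1\right].$$
   Context: $(x)_0=1$ and $(x)_n=x(x+1)\cdots(x+n-1)$ for $n\ge1$. The generalized hypergeometric series is ${}_pF_q\left[\begin{matrix}a_1,\dots,a_p\\ b_1,\dots,b_q\end{matrix};z\right]=\sum_{k\ge0}\frac{(a_1)_k\cdots(a_p)_k}{(b_1)_k\cdots(b_q)_k}\frac{z^k}{k!}$, with lower parameters $b_j\in\mathbb{C}\setminus\mathbb{Z}_{\le0}$. The series involved terminate; a term whose coefficient vanishes because of the factor $n$ (when $n=0$) is read as $0$. *)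

(* Defs.v *)
From HB Require Import structures.
From mathcomp Require Import all_boot all_order all_algebra.
From mathcomp Require Import complex.
From mathcomp Require Import all_classical all_reals all_analysis.
Import Order.TTheory GRing.Theory Num.Theory numFieldNormedType.Exports.

Set Implicit Arguments.
Unset Strict Implicit.
Unset Printing Implicit Defensive.

Local Open Scope ring_scope.

Definition poch (K : fieldType) (x : K) (n : nat) : K :=
  \prod_(i < n) (x + i%:R).

Definition pFq_term (K : fieldType) (us ls : seq K) (z : K) (k : nat) : K :=
  (\prod_(u <- us) poch u k) / (\prod_(l <- ls) poch l k) * (z ^+ k / k`!%:R).

(* The topology of the modulus on [R[i]] is only declared on the alias [R[i]^o].
   [limn] is total: it is an unspecified value when the series diverges. *)
Definition pFq (R : realType) (us ls : seq R[i]) (z : R[i]) : R[i] :=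
  limn (series (pFq_term us ls z : nat -> (R[i])^o)).

Definition nonpos_integer (K : fieldType) (x : K) : Prop :=
  exists m : nat, x = - m%:R.

Definition no_nonpos_integer (K : fieldType) (ls : seq K) : Prop :=
  forall l, l \in ls -> ~ nonpos_integer l.

(* A terminating series converges to its finite sum. *)
Lemma pFq_terminating (R : realType) (us ls : seq R[i]) (z : R[i]) (m : nat) :
  - m%:R \in us ->
  (series (pFq_term us ls z : nat -> (R[i])^o) @ \oo
     --> (\sum_(0 <= k < m.+1) pFq_term us ls z k : (R[i])^o))%classic /\
  pFq us ls z = \sum_(0 <= k < m.+1) pFq_term us ls z k.
Proof.
move=> mus.
have term0 k : (m < k)%N -> pFq_term us ls z k = 0.
  move=> mk; rewrite /pFq_term (big_rem _ mus) /= /poch.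
  by rewrite (bigD1 (Ordinal mk)) //= addNr !mul0r.
have cvgS : (series (pFq_term us ls z : nat -> (R[i])^o) @ \oo
     --> (\sum_(0 <= k < m.+1) pFq_term us ls z k : (R[i])^o))%classic.
  apply: cvg_near_cst; exists m.+1 => // N /= mN.
  rewrite /series /= (big_cat_nat (leq0n m.+1) mN) //= [X in _ + X]big1_seq ?addr0 //.
  by move=> k /andP[_]; rewrite mem_index_iota => /andP[/term0].
by split=> //; apply: cvg_lim cvgS; exact: norm_hausdorff.
Qed.

(* Main.v *)
Require Import Defs.
From mathcomp Require Import all_boot all_order all_algebra.
From mathcomp Require Import complex.
From mathcomp Require Import all_classical all_reals all_analysis.
From mathcomp Require Import ring zify.
Import Order.TTheory GRing.Theory Num.Theory numFieldNormedType.Exports.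
Local Open Scope ring_scope.

(** Both series are the two halves of one finite convolution.  Put
    P_j(a) = (-1)^j (a - ceil(j/2))_j, a product of j consecutive factors
    centred near a.  The identity behind the theorem is
      (c - a)_n = sum_j C(n,j) P_j(a) (c + ceil(j/2) - 1)_{n-j}.
    For j = 2k, reflection gives P_j(a) = (-1)^k (a)_k (1-a)_k, the remaining
    factor (c + k - 1)_{n-2k} is the middle part of (c - 1)_n, and C(n,2k) is
    a quotient of half-integer Pochhammer symbols by the duplication formula;
    divided by (c)_n, this is the k-th term of the first series with its
    prefactor ([even_term]).  The indices j = 2k+1 give the second series in
    the same way ([odd_term]).

    Both sides of the convolution identity are polynomials in a, so it
    suffices to compare their values at a = 0 and their forward differences
    in a ([polynomial_eq_diff]).  The difference of P_{j+1} is a multiple of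
    P_j, at a for even j but at a + 1 for odd j.  Hence the difference of the
    convolution of order n+1 is not the same convolution of order n but a
    companion, built with floor(j/2) in place of ceil(j/2) and ceil(j/2) - 1, and
    the difference of the companion is the original again, with a and c shifted
    by one.  An induction on n that treats the
    two together therefore closes ([central_convolution_sum]).  At a = 0 all
    but the first one or two terms vanish. *)

(** * Pochhammer symbols *)

Lemma poch0 {K : fieldType} (x : K) : poch x 0 = 1.
Proof. by rewrite /poch big_ord0. Qed.

Lemma pochS {K : fieldType} (x : K) n : poch x n.+1 = poch x n * (x + n%:R).
Proof. by rewrite /poch big_ord_recr. Qed.

Lemma pochD {K : fieldType} (x : K) m n :
  poch x (m + n) = poch x m * poch (x + m%:R) n.
Proof.
elim: n => [|n IHn]; first by rewrite addn0 poch0 mulr1.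
by rewrite addnS !pochS IHn natrD; ring.
Qed.

Lemma pochSl {K : fieldType} (x : K) n : poch x n.+1 = x * poch (x + 1) n.
Proof. by rewrite -add1n pochD pochS poch0 addr0 mul1r. Qed.

(** Negating each of the k factors reverses their order. *)
Lemma poch_reflect {K : fieldType} (x : K) k :
  poch x k = (-1) ^+ k * poch (1 - x - k%:R) k.
Proof.
elim: k x => [|k IHk] x; first by rewrite !poch0 mulr1.
rewrite pochS IHk pochSl exprS.
have -> : 1 - x - k.+1%:R + 1 = 1 - x - k%:R by ring.
by ring.
Qed.

Lemma poch_diff {K : fieldType} (x : K) n :
  poch (x + 1) n.+1 - poch x n.+1 = n.+1%:R * poch (x + 1) n.
Proof. by rewrite [X in X - _]pochS [X in _ - X]pochSl -natr1; ring. Qed.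

(** The even- and odd-indexed factors of (x)_{2k} are twice the factors of the
    two symbols on the left, whence 4^k. *)
Lemma poch_duplication {K : fieldType} (x : K) k : 2%:R != 0 :> K ->
  4%:R ^+ k * (poch (x / 2%:R) k * poch ((x + 1) / 2%:R) k) = poch x k.*2.
Proof.
move=> two0; elim: k => [|k IHk]; first by rewrite !poch0 !mulr1.
by rewrite doubleS !pochS -IHk exprS -muln2; field.
Qed.

Lemma poch_neq0 {K : fieldType} (x : K) k : ~ nonpos_integer x -> poch x k != 0.
Proof.
move=> xN; apply/prodf_neq0 => i _; apply/eqP => /eqP.
by rewrite addr_eq0 => /eqP ?; apply: xN; exists i.
Qed.

Lemma poch1 {K : fieldType} n : poch (1 : K) n = n`!%:R.
Proof.
by elim: n => [|n IHn]; rewrite ?poch0// pochS IHn factS mulnC natrM -natr1 addrC.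
Qed.

Lemma poch2 {K : fieldType} n : poch (2%:R : K) n = n.+1`!%:R.
Proof. by rewrite -poch1 pochSl mul1r. Qed.

Lemma poch_opp_nat {K : fieldType} n j :
  poch (- n%:R : K) j = (-1) ^+ j * ('C(n, j) * j`!)%:R.
Proof.
rewrite bin_ffact; elim: j => [|j IHj]; first by rewrite poch0 mul1r.
rewrite pochS IHj ffactnSr natrM exprS; case: (leqP j n) => [jn|nj].
  by rewrite natrB //; ring.
by rewrite ffact_small // !(mul0r, mulr0).
Qed.

(** Duplication at x = 1. *)
Lemma half_pochs {K : numFieldType} k :
  4%:R ^+ k * (poch (1 / 2%:R : K) k * k`!%:R) = (k.*2)`!%:R.
Proof.
by rewrite -poch1 -poch1 -poch_duplication ?pnatr_eq0// -[1 + 1]/2%:R divff ?pnatr_eq0.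
Qed.

(** Duplication at x = 2. *)
Lemma threehalves_pochs {K : numFieldType} k :
  4%:R ^+ k * (poch (3%:R / 2%:R : K) k * k`!%:R) = (k.*2.+1)`!%:R.
Proof.
rewrite -poch1 -poch2 -poch_duplication ?pnatr_eq0// divff ?pnatr_eq0//.
by rewrite natr1 [poch 1 k * _]mulrC.
Qed.

(** * The convolution identity *)

Definition central_factorial {K : fieldType} j (a : K) : K :=
  (-1) ^+ j * poch (a - (uphalf j)%:R) j.

(** A difference of (x)_{j+1} drops one factor.  What remains is centred as
    [central_factorial j] prescribes only when j is even; when j is odd the
    centre moves by one. *)
Lemma central_factorial_diff {K : fieldType} j (a : K) :
  central_factorial j.+1 (a + 1) - central_factorial j.+1 a =
  - j.+1%:R * central_factorial j (a + (odd j)%:R).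
Proof.
rewrite /central_factorial -mulrBr addrAC poch_diff exprS.
have -> : a - (uphalf j.+1)%:R + 1 = a + (odd j)%:R - (uphalf j)%:R.
  by rewrite [uphalf j.+1]/= !uphalf_half natrD -natr1; case: (odd j) => /=; ring.
by ring.
Qed.

Lemma central_factorial_root {K : fieldType} j m :
  (m <= uphalf j < j + m)%N -> central_factorial j (m%:R : K) = 0.
Proof.
case/andP=> mu uj; have ltj : (uphalf j - m < j)%N by rewrite ltn_subLR // addnC.
rewrite /central_factorial /poch (bigD1 (Ordinal ltj)) //= natrB //.
by rewrite [_ - _ + _](_ : _ = 0) ?mul0r ?mulr0 //; ring.
Qed.

(** For [b] false the shifts are those of the theorem, (a - ceil(j/2))_j and
    (c + ceil(j/2) - 1)_{n-j}; for [b] true they become (a - floor(j/2))_j and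
    (c + floor(j/2))_{n-j}.  The flag corrects the argument according to the
    parity of [j], so that [central_factorial_diff] applies to both. *)
Definition central_convolution {K : fieldType} (b : bool) n (a c : K) : K :=
  \sum_(j < n.+1) 'C(n, j)%:R * central_factorial j (a + (b && odd j)%:R) *
     poch (c + (b && ~~ odd j)%:R + (uphalf j)%:R - 1) (n - j).

(** The term [j = 0] is constant in [a]; on the others the parity of the index
    drops by one under the difference, which exchanges the two conventions. *)
Lemma central_convolution_diff {K : fieldType} b n (a c : K) :
  central_convolution b n.+1 (a + 1) c - central_convolution b n.+1 a c =
  - n.+1%:R * central_convolution (~~ b) n (a + b%:R) (c + b%:R).
Proof.
rewrite /central_convolution -sumrB big_ord_recl /= !andbF /central_factorial !poch0.
rewrite subrr add0r mulr_sumr.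
apply: eq_bigr => -[j jn] _ /=; rewrite /bump leq0n add1n -/(central_factorial _ _).
rewrite -/(central_factorial j.+1 _) subSS [a + 1 + _]addrAC.
rewrite -mulrBl -mulrBr central_factorial_diff.
have -> : a + (b && odd j.+1)%:R + (odd j)%:R = a + b%:R + (~~ b && odd j)%:R :> K.
  by rewrite [odd j.+1]/=; case: b (odd j) => [] [] /=; ring.
have -> : c + (b && ~~ odd j.+1)%:R + (uphalf j.+1)%:R - 1 =
          c + b%:R + (~~ b && ~~ odd j)%:R + (uphalf j)%:R - 1 :> K.
  rewrite [uphalf j.+1]/= uphalf_half natrD -natr1 /= negbK.
  by case: b (odd j) => [] [] /=; ring.
have binS : 'C(n.+1, j.+1)%:R * j.+1%:R = n.+1%:R * 'C(n, j)%:R :> K.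
  by rewrite -!natrM [(n.+1 * _)%N]mul_bin_diag mulnC.
by rewrite !mulrA mulrN binS !mulNr.
Qed.

(** At [a = 0] the factor 0 occurs in every central factorial of positive
    index, except for [j = 1] when [b] is false: then
    (c - 1)_n + n (c)_{n-1} = (c)_n. *)
Lemma central_convolution_0 {K : fieldType} b n (c : K) :
  central_convolution b n 0 c = poch c n.
Proof.
rewrite /central_convolution big_ord_recl /= !andbF bin0 subn0 /central_factorial poch0.
rewrite !mul1r.
case: b => /=.
  rewrite big1 ?addr0 => [|[j jn] _]; first by congr poch; ring.
  rewrite -/(central_factorial _ _) add0r central_factorial_root ?mulr0 ?mul0r //=.
  rewrite /bump leq0n add1n /=.
  by rewrite add0n; case: (boolP (odd j)) => /=; lia.
case: n => [|n]; first by rewrite big_ord0 !poch0 addr0.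
rewrite big_ord_recl /= big1 ?addr0 => [|[j jn] _]; last first.
  have P0 : central_factorial j.+2 (0 : K) = 0.
    by apply: (central_factorial_root j.+2 0) => /=; lia.
  by rewrite /bump !leq0n !add1n add0n -/(central_factorial j.+2 0) P0 mulr0 mul0r.
rewrite /bump /= bin1 subSS subn0 expr1 [poch (c - 1) _]pochSl subrK.
rewrite [poch (0 - 1) _]pochS poch0 [poch c n.+1]pochS addrK -natr1.
by ring.
Qed.

(** Such polynomials agree at every natural number, and in characteristic 0
    these are infinitely many points. *)
Lemma polynomial_eq_diff {K : numFieldType} (p q : {poly K}) :
  p.[0] = q.[0] -> (forall a, p.[a + 1] - p.[a] = q.[a + 1] - q.[a]) -> p = q.
Proof.
move=> pq0 pqD; have pq (m : nat) : p.[m%:R] = q.[m%:R].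
  elim: m => [//|m IHm]; rewrite -natr1.
  by rewrite -[LHS](subrK p.[m%:R]) pqD IHm subrK.
apply/eqP; rewrite -subr_eq0; apply/negPn/negP => pq_neq0.
suff: (size [seq i%:R : K | i <- iota 0 (size (p - q)%R)] < size (p - q)%R)%N.
  by rewrite size_map size_iota ltnn.
apply: max_poly_roots => //.
  by apply/allP => _ /mapP[i _ ->]; rewrite rootE !hornerE pq subrr.
by rewrite map_inj_uniq ?iota_uniq //; apply: mulrIn; rewrite oner_eq0.
Qed.

Definition polynomial_fun {K : fieldType} (f : K -> K) := exists p, forall a, f a = p.[a].

Lemma central_convolution_polynomial {K : fieldType} b n (c : K) :
  polynomial_fun (fun a => central_convolution b n a c).
Proof.
exists (\sum_(j < n.+1) ('C(n, j)%:R * (-1) ^+ j *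
  poch (c + (b && ~~ odd j)%:R + (uphalf j)%:R - 1) (n - j))%:P *
  \prod_(i < j) ('X + ((b && odd j)%:R - (uphalf j)%:R + i%:R)%:P)) => a.
rewrite horner_sum; apply: eq_bigr => j _.
rewrite hornerM hornerC horner_prod /central_factorial {1}/poch.
rewrite mulrA mulrAC; congr (_ * _); apply: eq_bigr => i _.
by rewrite hornerD hornerX hornerC; ring.
Qed.

Lemma poch_polynomial {K : fieldType} n (c : K) :
  polynomial_fun (fun a => poch (c - a) n).
Proof.
exists (\prod_(i < n) ((c + i%:R)%:P - 'X)) => a.
by rewrite horner_prod; apply: eq_bigr => i _; rewrite hornerD hornerN hornerX hornerC; ring.
Qed.

(** Both sides have the same value at [a = 0], and by induction the same forward
    differences.  The induction ranges over both values of [b], which alternate. *)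
Lemma central_convolution_sum {K : numFieldType} b n (a c : K) :
  central_convolution b n a c = poch (c - a) n.
Proof.
elim: n b a c => [|n IHn] b a c.
  by rewrite /central_convolution big_ord1 /central_factorial !poch0 bin0 !mul1r.
have [p pE] := central_convolution_polynomial b n.+1 c; have [q qE] := poch_polynomial n.+1 c.
rewrite pE qE; congr horner; apply: polynomial_eq_diff.
  by rewrite -pE -qE central_convolution_0 subr0.
move=> x; rewrite -!pE -!qE central_convolution_diff IHn.
have -> : c + b%:R - (x + b%:R) = c - (x + 1) + 1 by ring.
have -> : c - x = c - (x + 1) + 1 by ring.
by rewrite -[RHS]opprB poch_diff mulNr.
Qed.

(** * The terms of even and odd index *)

Lemma sum_even_odd {V : nmodType} (f : nat -> V) n :
  \sum_(j < n) f j =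
  \sum_(k < uphalf n) f k.*2 + \sum_(k < n./2) f k.*2.+1.
Proof.
elim: n => [|n IHn]; first by rewrite !big_ord0 addr0.
rewrite big_ord_recr IHn /=.
have [on|en] := boolP (odd n).
  have -> : uphalf n = n./2.+1 by lia.
  rewrite [X in _ = _ + X]big_ord_recr /= addrA; congr (_ + f _); lia.
have -> : uphalf n = n./2 by lia.
rewrite [X in _ = X + _]big_ord_recr /= addrAC; congr (_ + _); congr (f _); lia.
Qed.

Lemma central_factorial_even {K : fieldType} k (a : K) :
  central_factorial k.*2 a = (-1) ^+ k * (poch a k * poch (1 - a) k).
Proof.
rewrite /central_factorial -signr_odd odd_double mul1r uphalf_double -addnn pochD subrK.
rewrite [poch (a - _) k]poch_reflect.
have -> : 1 - (a - k%:R) - k%:R = 1 - a by ring.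
by ring.
Qed.

Lemma central_factorial_odd {K : fieldType} k (a : K) :
  central_factorial k.*2.+1 a = (-1) ^+ k * (poch a k * poch (1 - a) k.+1).
Proof.
rewrite /central_factorial -signr_odd /= odd_double doubleK expr1 -addnn -addSn pochD subrK.
rewrite [poch (a - _) _]poch_reflect.
have -> : 1 - (a - k.+1%:R) - k.+1%:R = 1 - a by ring.
by rewrite exprS; ring.
Qed.

(** The first [k] factors of (x)_n, the last [k] read backwards, and the middle
    part.  This is where the lower parameter 2 - c - n of the series comes
    from: [x] is c - 1 in the even case, and c with n - 1 factors in the
    odd case. *)
Lemma poch_bracket {K : fieldType} (x : K) k m n : (k.*2 + m)%N = n ->
  poch x n = (-1) ^+ k *
    (poch x k * poch (1 - x - n%:R) k * poch (x + k%:R) m).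
Proof.
move=> <-; have -> : (k.*2 + m = k + (m + k))%N by lia.
rewrite !pochD [poch (x + k%:R + m%:R) k]poch_reflect !natrD.
have -> : 1 - (x + k%:R + m%:R) - k%:R = 1 - x - (k%:R + (m%:R + k%:R)) by ring.
by ring.
Qed.

Lemma poch_half_neq0 {K : numFieldType} k : poch (1 / 2%:R : K) k != 0.
Proof.
apply/eqP => h0; have /eqP := @half_pochs K k.
by rewrite h0 mul0r mulr0 eq_sym pnatr_eq0 -[_ == _]negbK -lt0n fact_gt0.
Qed.

Lemma poch_threehalves_neq0 {K : numFieldType} k : poch (3%:R / 2%:R : K) k != 0.
Proof.
apply/eqP => h0; have /eqP := @threehalves_pochs K k.
by rewrite h0 mul0r mulr0 eq_sym pnatr_eq0 -[_ == _]negbK -lt0n fact_gt0.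
Qed.

Lemma natr_fact_neq0 {K : numFieldType} k : k`!%:R != 0 :> K.
Proof. by rewrite pnatr_eq0 -lt0n fact_gt0. Qed.

(** By duplication the quotient is (-n)_{2k} / (2k)!. *)
Lemma even_coefficient {K : numFieldType} n k :
  poch (- (n%:R / 2%:R)) k * poch ((1 - n%:R) / 2%:R) k /
  (poch (1 / 2%:R) k * k`!%:R) = 'C(n, k.*2)%:R :> K.
Proof.
have four0 : 4%:R ^+ k != 0 :> K by rewrite expf_neq0 ?pnatr_eq0.
apply: (canLR (mulfK (mulf_neq0 (poch_half_neq0 k) (natr_fact_neq0 k)))).
apply: (mulfI four0).
rewrite [RHS]mulrCA half_pochs -mulNr [1 - n%:R]addrC poch_duplication ?pnatr_eq0 //.
by rewrite poch_opp_nat -signr_odd odd_double mul1r natrM.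
Qed.

(** By duplication the quotient is (1-n)_{2k} / (2k+1)!; the factor [n] completes
    the numerator to -(-n)_{2k+1}. *)
Lemma odd_coefficient {K : numFieldType} n k :
  n%:R * (poch ((1 - n%:R) / 2%:R) k * poch ((2%:R - n%:R) / 2%:R) k /
  (poch (3%:R / 2%:R) k * k`!%:R)) = 'C(n, k.*2.+1)%:R :> K.
Proof.
have four0 : 4%:R ^+ k != 0 :> K by rewrite expf_neq0 ?pnatr_eq0.
rewrite [LHS]mulrA.
apply: (canLR (mulfK (mulf_neq0 (poch_threehalves_neq0 k) (natr_fact_neq0 k)))).
apply: (mulfI four0); rewrite [RHS]mulrCA threehalves_pochs [LHS]mulrCA.
have -> : 2%:R - n%:R = 1 - n%:R + 1 :> K by ring.
rewrite poch_duplication ?pnatr_eq0 // -natrM.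
have := poch_opp_nat n k.*2.+1 (K := K).
by rewrite pochSl addrC -signr_odd /= odd_double mulNr mulN1r => /oppr_inj.
Qed.

Lemma even_term {K : numFieldType} n k (a c : K) :
    ~ nonpos_integer (c - 1) -> ~ nonpos_integer (2%:R - c - n%:R) ->
    1 - c - n%:R != 0 -> poch c n != 0 -> (k.*2 <= n)%N ->
  (1 - c) / (1 - c - n%:R) *
  pFq_term [:: - (n%:R / 2%:R); (1 - n%:R) / 2%:R; a; 1 - a]
           [:: 1 / 2%:R; c - 1; 2%:R - c - n%:R] 1 k =
  'C(n, k.*2)%:R * central_factorial k.*2 a * poch (c + k%:R - 1) (n - k.*2) / poch c n.
Proof.
move=> /(poch_neq0 _ k) c1 /(poch_neq0 _ k) c2 den1 den2 kn.
have half0 := poch_half_neq0 k (K := K).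
have fact0 := natr_fact_neq0 k (K := K).
have bracket : (1 - c) / (1 - c - n%:R) = (-1) ^+ k * (poch (c - 1) k *
    poch (2%:R - c - n%:R) k * poch (c + k%:R - 1) (n - k.*2)) / poch c n.
  have := poch_bracket (c - 1) _ _ _ (subnKC kn).
  have -> : 1 - (c - 1) - n%:R = 2%:R - c - n%:R by ring.
  rewrite [c - 1 + k%:R]addrAC => <-; apply/eqP; rewrite eqr_div //.
  (* (c - 1)_{n+1} computed from both ends relates (c - 1)_n to (c)_n. *)
  have := pochSl (c - 1) n; rewrite subrK pochS => e.
  by rewrite -[1 - c]opprB mulNr -e; apply/eqP; ring.
rewrite bracket -even_coefficient central_factorial_even.
rewrite /pFq_term !big_cons !big_nil !mulr1 expr1n.
by field; rewrite den2 fact0 half0 c1 c2.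
Qed.

Lemma odd_term {K : numFieldType} n k (a c : K) :
    ~ nonpos_integer c -> ~ nonpos_integer (2%:R - c - n%:R) ->
    poch c n != 0 -> (k.*2 < n)%N ->
  n%:R * (1 - a) / (1 - c - n%:R) *
  pFq_term [:: (1 - n%:R) / 2%:R; (2%:R - n%:R) / 2%:R; a; 2%:R - a]
           [:: 3%:R / 2%:R; c; 2%:R - c - n%:R] 1 k =
  - ('C(n, k.*2.+1)%:R * central_factorial k.*2.+1 a *
     poch (c + k%:R) (n - k.*2.+1) / poch c n).
Proof.
case: n => [//|n] /(poch_neq0 _ k) c1 /(poch_neq0 _ k) c2 den2 kn.
have half0 := poch_threehalves_neq0 k (K := K).
have fact0 := natr_fact_neq0 k (K := K).
have bracket : (1 - c - n.+1%:R)^-1 = - ((-1) ^+ k * (poch c k *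
    poch (2%:R - c - n.+1%:R) k * poch (c + k%:R) (n.+1 - k.*2.+1)) / poch c n.+1).
  have := poch_bracket c _ _ _ (subnKC (kn : (k.*2 <= n)%N)).
  have -> : 1 - c - n%:R = 2%:R - c - n.+1%:R by rewrite -natr1; ring.
  rewrite subSS => <-.
  have p0 : poch c n != 0 by move: den2; rewrite pochS mulf_eq0 negb_or => /andP[].
  have cn : c + n%:R != 0 by move: den2; rewrite pochS mulf_eq0 negb_or => /andP[].
  have -> : 1 - c - n.+1%:R = - (c + n%:R) by rewrite -natr1; ring.
  by rewrite pochS; field; rewrite p0 cn.
have -> : central_factorial k.*2.+1 a = (-1) ^+ k * (poch a k * ((1 - a) * poch (2%:R - a) k)).
  by rewrite central_factorial_odd pochSl; congr (_ * (_ * (_ * poch _ _))); ring.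
rewrite bracket -odd_coefficient.
rewrite /pFq_term !big_cons !big_nil !mulr1 expr1n.
by field; rewrite den2 fact0 half0 c1 c2.
Qed.

(** One of the first two upper parameters, according to the parity of [n], makes
    the series stop at n./2. *)
Lemma half_mem {K : numFieldType} n (x y : K) :
  - (n./2)%:R \in [:: - (n%:R / 2%:R); (1 - n%:R) / 2%:R; x; y].
Proof.
have two0 : 2%:R != 0 :> K by rewrite pnatr_eq0.
have nE : n%:R = (odd n)%:R + (n./2)%:R * 2%:R :> K.
  by rewrite -natrM muln2 -natrD odd_double_half.
rewrite !inE nE; case: (odd n) => /=; apply/orP; [right; apply/orP|]; left.
  by apply/eqP; field.
by apply/eqP; field.
Qed.

Theorem theorem3p2 (R : realType) (n : nat) (a c : R[i])
  (lower1 : no_nonpos_integer [:: 1 / 2%:R; c - 1; 2%:R - c - n%:R])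
  (lower2 : no_nonpos_integer [:: 3%:R / 2%:R; c; 2%:R - c - n%:R])
  (den1 : 1 - c - n%:R != 0)
  (den2 : poch c n != 0) :
  poch (c - a) n / poch c n =
    (1 - c) / (1 - c - n%:R) *
      pFq [:: - (n%:R / 2%:R); (1 - n%:R) / 2%:R; a; 1 - a]
          [:: 1 / 2%:R; c - 1; 2%:R - c - n%:R] 1
    - n%:R * (1 - a) / (1 - c - n%:R) *
      pFq [:: (1 - n%:R) / 2%:R; (2%:R - n%:R) / 2%:R; a; 2%:R - a]
          [:: 3%:R / 2%:R; c; 2%:R - c - n%:R] 1.
Proof.
have c1 : ~ nonpos_integer (c - 1) by apply: lower1; rewrite !inE eqxx !orbT.
have c0 : ~ nonpos_integer c by apply: lower2; rewrite !inE eqxx !orbT.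
have cn : ~ nonpos_integer (2%:R - c - n%:R).
  by apply: lower1; rewrite !inE eqxx !orbT.
have even_sum : (1 - c) / (1 - c - n%:R) *
      pFq [:: - (n%:R / 2%:R); (1 - n%:R) / 2%:R; a; 1 - a]
          [:: 1 / 2%:R; c - 1; 2%:R - c - n%:R] 1 =
    \sum_(k < uphalf n.+1) 'C(n, k.*2)%:R * central_factorial k.*2 a *
      poch (c + k%:R - 1) (n - k.*2) / poch c n.
  have [_ ->] := pFq_terminating [:: 1 / 2%:R; c - 1; 2%:R - c - n%:R] 1
    (half_mem n a (1 - a)).
  rewrite big_mkord mulr_sumr; apply: eq_bigr => -[k kn] _ /=.
  by apply: even_term => //; lia.
have odd_sum : n%:R * (1 - a) / (1 - c - n%:R) *
      pFq [:: (1 - n%:R) / 2%:R; (2%:R - n%:R) / 2%:R; a; 2%:R - a]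
          [:: 3%:R / 2%:R; c; 2%:R - c - n%:R] 1 =
    - (\sum_(k < n.+1./2) 'C(n, k.*2.+1)%:R * central_factorial k.*2.+1 a *
      poch (c + k%:R) (n - k.*2.+1) / poch c n).
  (* For n = 0 the upper parameters 1/2 and 1 do not terminate the series, but
     its prefactor vanishes and the right-hand sum is empty. *)
  case: (posnP n) => [-> | n_gt0]; first by rewrite !mul0r big_ord0 oppr0.
  (* The first two upper parameters are those of the first series for n - 1. *)
  have mem : - (n.-1./2)%:R \in
      ([:: (1 - n%:R) / 2%:R; (2%:R - n%:R) / 2%:R; a; 2%:R - a] : seq R[i]).
    have nE : n%:R = n.-1%:R + 1 :> R[i] by rewrite natr1 prednK.
    have -> : 1 - n%:R = - n.-1%:R :> R[i] by rewrite nE; ring.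
    have -> : 2%:R - n%:R = 1 - n.-1%:R :> R[i] by rewrite nE; ring.
    by rewrite mulNr; exact: half_mem.
  have [_ ->] := pFq_terminating [:: 3%:R / 2%:R; c; 2%:R - c - n%:R] 1 mem.
  have -> : n.+1./2 = n.-1./2.+1 by lia.
  rewrite big_mkord mulr_sumr -sumrN; apply: eq_bigr => -[k kn] _ /=.
  by apply: odd_term => //; lia.
rewrite even_sum odd_sum opprK -(central_convolution_sum false) /central_convolution mulr_suml.
rewrite (sum_even_odd (fun j => 'C(n, j)%:R * central_factorial j (a + 0) *
  poch (c + 0 + (uphalf j)%:R - 1) (n - j) / poch c n)).
congr (_ + _); apply: eq_bigr => k _; rewrite !addr0.
  by rewrite uphalf_double.
by rewrite /= doubleK -natr1 addrA addrK.
Qed.
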